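(* Let $S$ be a positive normal affine semigroup with support forms $\sigma_1,\dots,\sigma_s$, $s=\#\operatorname{supp}(S)$, and let $\xi=(\xi_1,\dots,\xi_n): S\to \mathbb{Z}_+^n$ be an embedding (injective semigroup homomorphism). Then $\xi$ is a pure embedding if and only if $n\ge s$ and, up to renumbering, there exist $e_i\in\mathbb{Z}$, $e_i>0$, such that $\xi_i=e_i\sigma_i$ for $i=1,\dots,s$. Moreover, each of $\xi_{s+1},\dots,\xi_n$ is then a rational linear combination of $\sigma_1,\dots,\sigma_s$ with non-negative coefficients.
   Context: Semigroups are commutative, written additively, with $0$. An affine semigroup is a finitely generated subsemigroup of some $\mathbb{Z}^m$; $\operatorname{gp}(S)$ is its group of differences; $S$ is normal if every $x\in\operatorname{gp}(S)$ with $mx\in S$ for some integer $m>0$ lies in $S$, and positive if $0$ is its only invertible element. Identify $\operatorname{gp}(S)=\mathbb{Z}^r$, $r=\operatorname{rank}S$, and let $C(S)\subset\mathbb{R}^r$ be the cone generated by $S$. The support forms $\sigma_1,\dots,\sigma_s$ are the (unique up to order) linear forms on $\mathbb{R}^r$ with coprime integer coefficients such that $C(S)=\{x:\sigma_i(x)\ge0,\ i=1,\dots,s\}$ is an irredundant representation, and $\operatorname{supp}(S)=\{\sigma_1,\dots,\sigma_s\}$. If $S\subset T$ are affine semigroups, $S$ is a pure subsemigroup of $T$ if $S=T\cap\operatorname{gp}(S)$ in $\operatorname{gp}(T)$; an injective homomorphism $\xi:S\to T$ is pure if $\xi(S)$ is a pure subsemigroup of $T$. The components $\xi_i$ of $\xi$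 are extended to $\mathbb{Z}$-linear forms on $\operatorname{gp}(S)$. *)

(* Defs.v *)
From mathcomp Require Import all_boot all_order all_algebra perm.
From mathcomp Require Import boolp classical_sets functions reals.

Set Implicit Arguments.
Unset Strict Implicit.
Unset Printing Implicit Defensive.

Import Order.TTheory GRing.Theory Num.Theory.

Local Open Scope classical_set_scope.
Local Open Scope ring_scope.

Section AffineSemigroups.
Variable m : nat.
Implicit Types S T : set 'rV[int]_m.

Definition affine_semigroup S : Prop :=
  exists (k : nat) (g : 'I_k -> 'rV[int]_m),
    S = [set x | exists c : 'I_k -> nat, x = \sum_(i < k) g i *+ c i].

Definition gp S : set 'rV[int]_m :=
  [set x | exists a b, [/\ S a, S b & x = a - b]].

Definition normal_semigroup S : Prop :=
  forall (x : 'rV[int]_m) (k : nat), gp S x -> (0 < k)%N -> S (x *+ k) -> S x.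

Definition positive_semigroup S : Prop :=
  forall x, S x -> S (- x) -> x = 0.

Definition pure_subsemigroup S T : Prop :=
  S `<=` T /\ S = T `&` gp S.

End AffineSemigroups.

Definition nonneg_orthant (n : nat) : set 'rV[int]_n :=
  [set x : 'rV[int]_n | forall i, 0 <= x 0 i].

(* A map defined on S is represented by a total function; its values outside
   S are never used. *)
Definition embedding (m n : nat) (S : set 'rV[int]_m) (T : set 'rV[int]_n)
    (xi : 'rV[int]_m -> 'rV[int]_n) : Prop :=
  [/\ forall x, S x -> T (xi x),
      xi 0 = 0,
      forall x y, S x -> S y -> xi (x + y) = xi x + xi y
    & forall x y, S x -> S y -> xi x = xi y -> x = y].

Definition pure_embedding (m n : nat) (S : set 'rV[int]_m)
    (T : set 'rV[int]_n) (xi : 'rV[int]_m -> 'rV[int]_n) : Prop :=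
  embedding S T xi /\ pure_subsemigroup (xi @` S) T.

(* The value at x of the extension of xi to gp S: xi a - xi b for a chosen
   decomposition x = a - b with a, b in S. When xi is a homomorphism on S this
   does not depend on the choice. *)
Definition gp_ext (m n : nat) (S : set 'rV[int]_m)
    (xi : 'rV[int]_m -> 'rV[int]_n) (x : 'rV[int]_m) : 'rV[int]_n :=
  let p := xget (0, 0) [set p | [/\ S p.1, S p.2 & x = p.1 - p.2]] in
  xi p.1 - xi p.2.

(* The linear form with integer coefficient vector a, on K^r. *)
Definition lform (K : pzRingType) (r : nat) (a : 'rV[int]_r) (x : 'rV[K]_r) : K :=
  \sum_(k < r) (a 0 k)%:~R * x 0 k.

Definition coprime_coefs (r : nat) (a : 'rV[int]_r) : Prop :=
  \big[gcdn/0%N]_(k < r) absz (a 0 k) = 1%N.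

Definition cone (R : realType) (r : nat) (A : set 'rV[int]_r) : set 'rV[R]_r :=
  [set x | exists (k : nat) (a : 'I_k -> 'rV[int]_r) (c : 'I_k -> R),
    [/\ forall i, A (a i), forall i, 0 <= c i
      & x = \sum_(i < k) c i *: map_mx intr (a i)]].
Arguments cone R {r} A.

(* sigma enumerates the support forms of a semigroup A with gp A = Z^r.
   Irredundancy also makes the sigma i pairwise distinct, so that s is the
   number of support forms. *)
Definition support_forms (R : realType) (r s : nat) (A : set 'rV[int]_r)
    (sigma : 'I_s -> 'rV[int]_r) : Prop :=
  [/\ forall i, coprime_coefs (sigma i),
      cone R A = [set x | forall i, 0 <= lform (sigma i) x]
    & forall i, cone R A <> [set x | forall j, j != i -> 0 <= lform (sigma j) x]].

(* An identification of gp S with Z^r; its existence forces r = rank S. *)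
Definition gp_identification (m r : nat) (S : set 'rV[int]_m)
    (iota : {additive 'rV[int]_r -> 'rV[int]_m}) : Prop :=
  injective iota /\ range iota = gp S.

(* After renumbering the components of xi by pi, the first s of them are
   positive integer multiples of the support forms. *)
Definition starts_with_support_forms (m r s n : nat) (S : set 'rV[int]_m)
    (iota : 'rV[int]_r -> 'rV[int]_m) (sigma : 'I_s -> 'rV[int]_r)
    (xi : 'rV[int]_m -> 'rV[int]_n) (hsn : (s <= n)%N) (pi : 'S_n) : Prop :=
  exists e : 'I_s -> int,
    forall i, 0 < e i /\
      forall y, gp_ext S xi (iota y) 0 (pi (widen_ord hsn i))
                = e i * lform (sigma i) y.

(* Main.v *)
Require Import Defs.
From HB Require Import structures.
From mathcomp Require Import all_boot all_order all_algebra perm.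
From mathcomp Require Import boolp classical_sets functions reals.
From mathcomp Require Import ring lra.

Set Implicit Arguments.
Unset Strict Implicit.
Unset Printing Implicit Defensive.

Import Order.TTheory GRing.Theory Num.Theory.

Local Open Scope classical_set_scope.
Local Open Scope ring_scope.

(* After identifying [gp S] with [Z^r], let [A] be the preimage of [S] and
   write the components of [xi] as integer forms [ell_j].  Injectivity of [xi]
   makes purity equivalent to [A = {y | ell_j y >= 0 for all j}].
   If the support forms occur among the [ell_j] up to positive factors, this
   equality follows from normality, because an integer point of the real cone
   over [A] is a rational non-negative combination of elements of [A].
   Conversely, Farkas' lemma over the rationals writes each [ell_j] as a
   non-negative combination of the [sigma_k], and each [sigma_i] as a
   non-negative combination of the [ell_j].  Substituting one into the other
   and using irredundancy, the product of the two coefficient matrices is the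
   identity, so some [ell_j] is a positive multiple of [sigma_i]; the factor is
   an integer because the coefficients of [sigma_i] are coprime. *)

(** * Farkas' lemma over an ordered field *)

(** By induction on [k]. If [b] is already non-negative wherever the forms other than [a ord0] are,
    then [a ord0] gets coefficient 0. Otherwise some [y] witnesses the failure, and projecting along
    [y] onto the kernel of [a ord0] eliminates that form. *)
Lemma farkas (F : realFieldType) (r k : nat) (a : 'I_k -> 'rV[F]_r)
    (b : 'rV[F]_r) :
  (forall x : 'cV[F]_r, (forall i, 0 <= (a i *m x) 0 0) -> 0 <= (b *m x) 0 0) ->
  exists c : 'I_k -> F, (forall i, 0 <= c i) /\ b = \sum_(i < k) c i *: a i.
Proof.
elim: k a b => [|k IH] a b hb.
  exists (fun=> 0); split=> //; rewrite big_ord0.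
  apply/rowP => i; rewrite [RHS]mxE.
  have hb' (x : 'cV[F]_r) : 0 <= (b *m x) 0 0 by apply: hb => -[].
  have bE (x : 'cV[F]_r) : (b *m x) 0 0 = 0.
    by apply/eqP; rewrite eq_le hb' andbT; have := hb' (- x);
      rewrite mulmxN mxE oppr_ge0.
  by have := bE (delta_mx i 0); rewrite -colE mxE.
have [hb0|] := pselect (forall x : 'cV[F]_r,
    (forall i : 'I_k, 0 <= (a (lift ord0 i) *m x) 0 0) -> 0 <= (b *m x) 0 0).
  have [c [c0 bE]] := IH _ _ hb0.
  exists (fun i => oapp c 0 (unlift ord0 i)); split.
    by move=> i; case: unliftP => [j _|_] /=.
  rewrite big_ord_recl unlift_none /= scale0r add0r bE.
  by apply: eq_bigr => i _; rewrite liftK.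
move=> /existsNP[y /not_implyP[ay /negP]]; rewrite -ltNge => by0.
have a0y : (a ord0 *m y) 0 0 < 0.
  rewrite ltNge; apply/negP => a0y; move: by0; rewrite ltNge hb// => i.
  by case: (unliftP ord0 i) => [j|] ->.
set t := (a ord0 *m y) 0 0 in a0y.
have mxBE (M N : 'M[F]_1) c : (M - c *: N) 0 0 = M 0 0 - c * N 0 0.
  by rewrite !mxE.
pose p (u : 'rV[F]_r) := u - ((u *m y) 0 0 / t) *: a ord0.
have pE u (x : 'cV[F]_r) : (p u *m x) 0 0 =
    (u *m x) 0 0 - (u *m y) 0 0 / t * (a ord0 *m x) 0 0.
  by rewrite mulmxBl -scalemxAl mxBE.
have t0 : t != 0 by rewrite lt_eqF.
have [|c [c0 bE]] := IH (p \o (fun i => a (lift ord0 i))) (p b).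
  (* [p u] at [x] is [u] at the projection of [x] along [y] onto [ker (a 0)]. *)
  move=> x hx; pose x' := x - ((a ord0 *m x) 0 0 / t) *: y.
  have px u : (p u *m x) 0 0 = (u *m x') 0 0.
    by rewrite pE /x' mulmxBr -scalemxAr mxBE; ring.
  rewrite px; apply: hb => i; case: (unliftP ord0 i) => [j|] ->.
    by rewrite -px hx.
  by rewrite -px pE mulfV// mul1r subrr.
(* The coefficient of [a ord0] collects the corrections made by [p]. It is non-negative because
   [a ord0] and [b] are negative at [y] while the other forms are not. *)
exists (fun i => oapp c ((b *m y) 0 0 / t
    - \sum_(j < k) c j * ((a (lift ord0 j) *m y) 0 0 / t)) (unlift ord0 i)).
split.
  move=> i; case: unliftP => [j _|_] /=; first exact: c0.
  rewrite subr_ge0; apply: (@le_trans _ _ 0).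
    apply: sumr_le0 => j _; rewrite mulr_ge0_le0//.
    by rewrite mulr_ge0_le0// invr_le0 ltW.
  by rewrite mulr_le0// ?invr_le0 ltW.
rewrite big_ord_recl unlift_none /= scalerBl -addrA.
rewrite -[LHS](subrK ((b *m y) 0 0 / t *: a ord0)) addrC; congr (_ + _).
rewrite -[LHS]/(p b) bE scaler_suml -sumrN -big_split /=.
by apply: eq_bigr => j _; rewrite liftK /= scalerBr scalerA addrC.
Qed.

(** * Evaluation of integer linear forms *)

Lemma lformE (K : comPzRingType) (r : nat) (a : 'rV[int]_r) (x : 'rV[K]_r) :
  lform a x = (map_mx intr a *m x^T) 0 0.
Proof. by rewrite /lform !mxE; apply: eq_bigr => i _; rewrite !mxE. Qed.

Lemma lform_intr (K : comPzRingType) (r : nat) (a y : 'rV[int]_r) :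
  lform a (map_mx intr y : 'rV[K]_r) = (lform a y)%:~R.
Proof.
rewrite /lform rmorph_sum; apply: eq_bigr => i _.
by rewrite !mxE intz rmorphM.
Qed.

Lemma lformC (r : nat) (a y : 'rV[int]_r) : lform a y = lform y a.
Proof. by apply: eq_bigr => i _; rewrite !intz mulrC. Qed.

Lemma lformB (K : comPzRingType) (r : nat) (a : 'rV[int]_r) (x y : 'rV[K]_r) :
  lform a (x - y) = lform a x - lform a y.
Proof. by rewrite !lformE linearB mulmxBr !mxE. Qed.

Lemma lformZ (K : comPzRingType) (r : nat) (a : 'rV[int]_r) c (x : 'rV[K]_r) :
  lform a (c *: x) = c * lform a x.
Proof. by rewrite !lformE linearZ -scalemxAr !mxE. Qed.

Lemma lform_sum (K : comPzRingType) (r k : nat) (a : 'rV[int]_r)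
    (x : 'I_k -> 'rV[K]_r) :
  lform a (\sum_i x i) = \sum_i lform a (x i).
Proof.
rewrite lformE linear_sum mulmx_sumr summxE.
by apply: eq_bigr => i _; rewrite lformE.
Qed.

Lemma lform_delta (K : comPzRingType) (r : nat) (a : 'rV[int]_r) (k : 'I_r) :
  lform a (delta_mx 0 k : 'rV[K]_r) = (a 0 k)%:~R.
Proof. by rewrite lformE trmx_delta -colE !mxE. Qed.

(** Carries a rational relation between forms over to [K], so that it can be evaluated at real
    points. *)
Lemma lform_comb (K : numFieldType) (r k : nat) (a : 'I_k -> 'rV[int]_r)
    (b : 'rV[int]_r) (q : 'I_k -> rat) (x : 'rV[K]_r) :
  map_mx intr b = \sum_i q i *: map_mx intr (a i) ->
  lform b x = \sum_i ratr (q i) * lform (a i) x.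
Proof.
move=> bE; rewrite lformE.
have -> : map_mx intr b = \sum_i ratr (q i) *: map_mx intr (a i) :> 'rV[K]_r.
  apply/rowP => j; have := congr1 (fun u : 'rV_r => (ratr (u 0 j) : K)) bE.
  rewrite !mxE ratr_int summxE => ->; rewrite rmorph_sum summxE.
  by apply: eq_bigr => i _; rewrite !mxE rmorphM /= ratr_int.
rewrite mulmx_suml summxE; apply: eq_bigr => i _.
by rewrite -scalemxAl mxE lformE.
Qed.

(** * Rational combinations obtained from integer points *)

Lemma common_denominator (k : nat) (q : 'I_k -> rat) :
  exists (N : nat) (z : 'I_k -> int),
    (0 < N)%N /\ forall i, q i *+ N = (z i)%:~R.
Proof.
exists (\prod_i absz (denq (q i)))%N.
exists (fun i => numq (q i) * (\prod_(j | j != i) absz (denq (q j)))%N%:Z).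
split; first by rewrite prodn_gt0// => i; rewrite absz_gt0 denq_neq0.
move=> i; rewrite (bigD1 i)//= intrM mulrnA numqE -mulr_natr.
by congr (_ * _); rewrite -mulr_natr pmulrn absz_denq.
Qed.

(** Integer test points suffice: every rational point has a positive integral multiple, and positive
    scaling keeps the signs of forms. *)
Lemma int_farkas (r k : nat) (a : 'I_k -> 'rV[int]_r) (b : 'rV[int]_r) :
  (forall y : 'rV[int]_r, (forall i, 0 <= lform (a i) y) -> 0 <= lform b y) ->
  exists q : 'I_k -> rat, (forall i, 0 <= q i) /\
    map_mx intr b = \sum_i q i *: map_mx intr (a i).
Proof.
move=> hb; apply: farkas => x ax.
have [N [z [N0 xz]]] := common_denominator (fun i => x i 0).
have pE u : (map_mx intr u *m x) 0 0 *+ N = (lform u (\row_i z i))%:~R.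
  rewrite -lform_intr /lform mxE -sumrMnl; apply: eq_bigr => i _.
  by rewrite !mxE -xz mulrnAr.
rewrite -(pmulrn_lge0 _ N0) pE ler0z; apply: hb => i.
by rewrite -(ler0z rat) -pE pmulrn_lge0.
Qed.

(** * Integer points of the cone over a normal semigroup *)

Section NormalCone.
Variables (R : realType) (r : nat) (A : set 'rV[int]_r).

Lemma cone_lform_ge0 (b : 'rV[int]_r) (x : 'rV[R]_r) :
  (forall y, A y -> 0 <= lform b y) -> cone R A x -> 0 <= lform b x.
Proof.
move=> hb [k [a [c [aA c0 ->]]]]; rewrite lform_sum sumr_ge0// => i _.
by rewrite lformZ lform_intr mulr_ge0// ler0z hb.
Qed.

Lemma cone_intr (y : 'rV[int]_r) : A y -> cone R A (map_mx intr y).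
Proof.
by move=> Ay; exists 1%N, (fun=> y), (fun=> 1); split=> //;
  rewrite big_ord1 scale1r.
Qed.

(** The given combination for [y] has real coefficients. With the roles of forms and points
    exchanged, Farkas' lemma yields rational ones, and clearing denominators puts a positive
    multiple of [y] in [A]. *)
Lemma normal_cone_int (y : 'rV[int]_r) :
  A 0 -> (forall u v, A u -> A v -> A (u + v)) ->
  (forall u k, (0 < k)%N -> A (u *+ k) -> A u) ->
  cone R A (map_mx intr y) -> A y.
Proof.
move=> A0 AD An [k [a [c [aA c0 yE]]]].
have AM u j : A u -> A (u *+ j).
  by move=> Au; elim: j => // j IH; rewrite mulrS; apply: AD.
have [|q [q0 qE]] := int_farkas (a := a) (b := y).
  move=> x ax; rewrite -(ler0z R) lformC -lform_intr yE lform_sum.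
  rewrite sumr_ge0// => i _.
  by rewrite lformZ lform_intr mulr_ge0// ler0z lformC.
have [N [z [N0 qz]]] := common_denominator q.
apply: (An _ N) => //.
have -> : y *+ N = \sum_i a i *+ absz (z i).
  apply/rowP => j; apply: (@intr_inj rat).
  have := congr1 (fun u : 'rV_r => u 0 j *+ N) qE.
  rewrite !mxE summxE -sumrMnl !mulmxnE rmorphMn /= => ->.
  rewrite summxE rmorph_sum; apply: eq_bigr => i _.
  rewrite mulmxnE !mxE rmorphMn /= -mulrnAl qz -mulr_natl pmulrn gez0_abs//.
  by rewrite -(ler0z rat) -qz mulrn_wge0.
by elim/big_ind: _ => // i _; apply: AM.
Qed.

End NormalCone.

(** * Support forms and their irredundancy *)

Section SupportForms.
Variables (R : realType) (r s : nat) (A : set 'rV[int]_r).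
Variable sigma : 'I_s -> 'rV[int]_r.
Hypothesis sigmaA : support_forms R A sigma.

Lemma support_form_ge0 i y : A y -> 0 <= lform (sigma i) y.
Proof.
have [_ CE _] := sigmaA.
by move=> /(cone_intr R); rewrite CE => /(_ i); rewrite lform_intr ler0z.
Qed.

Lemma support_forms_comb (b : 'rV[int]_r) :
  (forall y, A y -> 0 <= lform b y) ->
  exists q : 'I_s -> rat, (forall i, 0 <= q i) /\
    map_mx intr b = \sum_i q i *: map_mx intr (sigma i).
Proof.
have [_ CE _] := sigmaA => hb; apply: int_farkas => y hy.
rewrite -(ler0z R) -lform_intr; apply: (cone_lform_ge0 hb).
by rewrite CE => i; rewrite lform_intr ler0z.
Qed.

(** Moving the term of index [i] to the left leaves a positive multiple of [sigma i]. So [sigma i]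
    would be non-negative wherever the other forms are, and could be dropped from the
    representation. *)
Lemma support_form_irredundant i (q : 'I_s -> rat) :
  (forall j, 0 <= q j) -> q i < 1 ->
  map_mx intr (sigma i) <> \sum_j q j *: map_mx intr (sigma j).
Proof.
have [_ CE irr] := sigmaA => q0 qi1 sE; apply: (irr i).
rewrite CE; apply/seteqP; split => x /= hx => [j _|j]; first exact: hx.
have [->|] := eqVneq j i; last exact: hx.
have xE := lform_comb x sE; rewrite (bigD1 i)//= in xE.
rewrite -(pmulr_rge0 _ (_ : 0 < 1 - ratr (q i))).
  rewrite mulrBl mul1r [X in X - _]xE addrAC subrr add0r sumr_ge0// => k ki.
  by rewrite mulr_ge0 ?hx// ler0q.
by rewrite subr_gt0 -(rmorph1 (@ratr R)) ltr_rat.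
Qed.

Lemma support_form_neq0 i : sigma i != 0.
Proof.
have [cop _ _] := sigmaA; apply/eqP => si0; have := cop i.
rewrite /coprime_coefs big1 => // k _; by rewrite si0 mxE.
Qed.

(** The denominator of [q] is coprime to its numerator, hence divides every coefficient of [a], and
    their gcd is 1. *)
Lemma coprime_coefs_scale (a b : 'rV[int]_r) (q : rat) :
  coprime_coefs a -> map_mx intr b = q *: map_mx intr a ->
  exists e : int, q = e%:~R.
Proof.
move=> cop bE; exists (numq q).
suff d1 : absz (denq q) = 1%N.
  by rewrite -[LHS]divq_num_den -absz_denq d1 divr1.
apply/eqP; rewrite -dvdn1 -cop; apply/dvdn_biggcdP => k _.
have : (b 0 k * denq q = numq q * a 0 k)%R.
  apply: (@intr_inj rat); rewrite !rmorphM /=.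
  have := congr1 (fun u : 'rV_r => u 0 k) bE; rewrite !mxE => ->.
  by rewrite mulrAC -numqE.
move=> /(congr1 absz); rewrite !abszM => e.
rewrite -(@Gauss_dvdr _ (absz (numq q))); first by rewrite -e dvdn_mull.
by rewrite coprime_sym coprime_num_den.
Qed.

(** For distinct [i] and [j], [sigma i] would be a non-negative combination with coefficient 0 at
    [i], against irredundancy. *)
Lemma support_form_scale i j (e f : int) : 0 < e -> 0 < f ->
  e *: sigma i = f *: sigma j -> i = j.
Proof.
move=> e0 f0 eE; apply/eqP/negP => /negP ij.
apply: (@support_form_irredundant i
  (fun k => if k == j then f%:~R / e%:~R else 0)).
- by move=> k; case: ifP => // _; rewrite divr_ge0// ler0z ltW.
- by rewrite (negPf ij).
rewrite (bigD1 j)//= eqxx big1 ?addr0; last first.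
  by move=> k /negPf ->; rewrite scale0r.
have e0' : e%:~R != 0 :> rat by rewrite intr_eq0 gt_eqF.
apply: (scalerI e0'); rewrite scalerA mulrCA mulfV// mulr1.
by rewrite -!map_mxZ eE.
Qed.

Lemma support_form_among n (ell : 'I_n -> 'rV[int]_r) :
  (forall y, exists a b, [/\ A a, A b & y = a - b]) ->
  (forall y, A y <-> forall j, 0 <= lform (ell j) y) ->
  forall i, exists j (e : int), 0 < e /\ ell j = e *: sigma i.
Proof.
move=> Agp AE i.
have [cop _ _] := sigmaA.
have [p [p0 pE]] : exists p : 'I_n -> rat, (forall i, 0 <= p i) /\
    map_mx intr (sigma i) = \sum_j p j *: map_mx intr (ell j).
  by apply: int_farkas => y hy; apply: support_form_ge0; apply/AE.
have /choice[Q QP] j : exists q : 'I_s -> rat, (forall i, 0 <= q i) /\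
    map_mx intr (ell j) = \sum_i q i *: map_mx intr (sigma i).
  by apply: support_forms_comb => y /AE.
have Q0 j k : 0 <= Q j k by case: (QP j).
(* Row [i] of the product of the two coefficient matrices. *)
pose M k := \sum_j p j * Q j k.
have M0 k : 0 <= M k by apply: sumr_ge0 => j _; rewrite mulr_ge0.
have ME : map_mx intr (sigma i) = \sum_k M k *: map_mx intr (sigma k).
  rewrite pE; under eq_bigr => j _.
    rewrite (QP j).2 scaler_sumr; under eq_bigr do rewrite scalerA; over.
  by rewrite exchange_big; apply: eq_bigr => k _; rewrite scaler_suml.
have Mi1 : 1 <= M i.
  by rewrite leNgt; apply/negP => /(support_form_irredundant M0).
have Mk0 k : k != i -> M k = 0.
  move=> ki; apply/eqP; apply: contraT => Mk.
  (* On [A] all terms of [ME] are non-negative, and the one of index [i] is already at least the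
     left side, so the term of index [k] vanishes. *)
  have sA a : A a -> lform (sigma k) a = 0.
    move=> Aa; have := lform_comb (map_mx intr a : 'rV[rat]_r) ME.
    under eq_bigr do rewrite lform_intr.
    rewrite lform_intr (bigD1 i)//= (bigD1 k)//=.
    have sge0 l : 0 <= (lform (sigma l) a)%:~R :> rat.
      by rewrite ler0z support_form_ge0.
    set T := (X in _ + (_ + X)) => E.
    have T0 : 0 <= T.
      by apply: sumr_ge0 => l _; rewrite mulr_ge0// ler0q.
    have Mk_gt0 : 0 < ratr (M k) :> rat by rewrite ltr0q lt_neqAle eq_sym Mk M0.
    have le1 := ler_peMl (sge0 i) (_ : 1 <= ratr (M i)).
    rewrite -(rmorph1 (@ratr rat)) ler_rat in le1; have {}le1 := le1 Mi1.
    have h0 : ratr (M k) * (lform (sigma k) a)%:~R <= 0 :> rat by lra.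
    have := mulr_ge0 (ltW Mk_gt0) (sge0 k) => h1.
    have /eqP : ratr (M k) * (lform (sigma k) a)%:~R = 0 :> rat by lra.
    by rewrite mulf_eq0 (gt_eqF Mk_gt0) /= intr_eq0 => /eqP.
  (* Unit vectors are differences of elements of [A], so a form vanishing on [A] is zero. *)
  have /negP[] := support_form_neq0 k.
  apply/eqP/rowP => l; rewrite mxE.
  have [a [b [Aa Ab dE]]] := Agp (delta_mx 0 l).
  have := lform_delta int (sigma k) l.
  by rewrite dE lformB !sA// subrr intz.
have [j pQ] : exists j, p j * Q j i != 0.
  apply: contrapT => /forallNP h; move: Mi1.
  rewrite /M big1 ?ler10// => j _.
  by have /negP := h j; rewrite negbK => /eqP.
have pj0 : p j != 0 by apply: contraNneq pQ => ->; rewrite mul0r.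
(* The sum [M k] is 0 with non-negative terms, so each term is 0, and [p j] is nonzero. *)
have Qk0 k : k != i -> Q j k = 0.
  move=> /Mk0 /eqP; rewrite /M psumr_eq0; last by move=> l _; rewrite mulr_ge0.
  by move=> /allP/(_ j (mem_index_enum _)); rewrite mulf_eq0 (negPf pj0) => /eqP.
have jE : map_mx intr (ell j) = Q j i *: map_mx intr (sigma i).
  rewrite (QP j).2 (bigD1 i)//= big1 ?addr0// => k /Qk0 ->.
  by rewrite scale0r.
have [e eE] := coprime_coefs_scale (cop i) jE.
exists j, e; split.
  rewrite -(ltr0z rat) -eE lt_neqAle Q0 andbT eq_sym.
  by apply: contraNneq pQ => ->; rewrite mulr0.
apply/rowP => k; apply: (@intr_inj rat).
have := congr1 (fun u : 'rV_r => u 0 k) jE.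
by rewrite eE !mxE rmorphM.
Qed.

End SupportForms.

(** * Renumbering, additive maps as forms, and closure of affine semigroups *)

(** The values of [f] in order, followed by the remaining indices, form a duplicate-free list of
    length [n]; the permutation reads off its entries. *)
Lemma injection_extends_perm s n (f : 'I_s -> 'I_n) (hsn : (s <= n)%N) :
  injective f -> exists pi : 'S_n, forall i, pi (widen_ord hsn i) = f i.
Proof.
move=> f_inj.
pose t := codom f ++ [seq x <- enum 'I_n | x \notin codom f].
have t_uniq : uniq t.
  rewrite cat_uniq filter_uniq ?enum_uniq// andbT map_inj_uniq// enum_uniq/=.
  by apply/hasPn => x; rewrite mem_filter => /andP[].
have t_size : size t = n.
  rewrite -[RHS](size_enum_ord n); apply/eqP.
  rewrite eqn_leq !uniq_leq_size ?enum_uniq// => x _; last by rewrite mem_enum.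
  by rewrite mem_cat mem_filter mem_enum andbT orbN.
pose g (i : 'I_n) := nth i t i.
have g_inj : injective g.
  move=> i j; rewrite /g (set_nth_default i) ?t_size// => /eqP.
  by rewrite nth_uniq ?t_size// => /eqP/val_inj.
exists (perm g_inj) => i; rewrite permE /g nth_cat size_codom card_ord /=.
by rewrite ltn_ord (nth_map i) ?nth_ord_enum// size_enum_ord.
Qed.

Lemma additive_lform r n (f : {additive 'rV[int]_r -> 'rV[int]_n}) y j :
  f y 0 j = lform (\row_k f (delta_mx 0 k) 0 j) y.
Proof.
rewrite {1}(row_sum_delta y) raddf_sum summxE; apply: eq_bigr => k _.
by rewrite -[y 0 k]intz scaler_int raddfMz -scaler_int !mxE !intz mulrC.
Qed.

Lemma affine_semigroup0 m (S : set 'rV[int]_m) : affine_semigroup S -> S 0.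
Proof.
by move=> [k [g ->]]; exists (fun=> 0%N); rewrite big1.
Qed.

Lemma affine_semigroupD m (S : set 'rV[int]_m) x y :
  affine_semigroup S -> S x -> S y -> S (x + y).
Proof.
move=> [k [g ->]] [c ->] [d ->]; exists (fun i => (c i + d i)%N).
by rewrite -big_split; apply: eq_bigr => i _; rewrite mulrnDr.
Qed.

(** * Extension of [xi] to the group of differences, and purity *)

Section Extension.
Variables (m n : nat) (S : set 'rV[int]_m) (xi : 'rV[int]_m -> 'rV[int]_n).
Hypothesis S_affine : affine_semigroup S.
Hypothesis xi_emb : embedding S (@nonneg_orthant n) xi.

(** From [a - b = c - d] follows [a + d = c + b], an equation in [S], where [xi] is additive. *)
Lemma gp_extB a b : S a -> S b -> gp_ext S xi (a - b) = xi a - xi b.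
Proof.
have [_ _ xiD _] := xi_emb => Sa Sb; rewrite /gp_ext.
set P := [set p | _].
(* The pair [(a, b)] inhabits [P], so [xget] returns a genuine decomposition and not its default. *)
have [/= Sc Sd] : P (xget (0, 0) P) by apply: (xgetPex (0, 0)); exists (a, b).
move: (xget _ _) Sc Sd => [c d] /= Sc Sd.
move=> /eqP; rewrite subr_eq addrAC eq_sym subr_eq => /eqP abcd.
apply/eqP; rewrite subr_eq addrAC eq_sym subr_eq.
by rewrite -!xiD// abcd.
Qed.

Lemma gp_ext_id a : S a -> gp_ext S xi a = xi a.
Proof.
have [_ xi0 _ _] := xi_emb => Sa.
by rewrite -[a in LHS]subr0 gp_extB ?xi0 ?subr0//; apply: affine_semigroup0.
Qed.

Variables (r : nat) (iota : {additive 'rV[int]_r -> 'rV[int]_m}).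
Hypothesis iota_gp : gp_identification S iota.

(** Since [x = x - 0], the set [S] lies in [gp S], the range of [iota], so decompositions in [gp S]
    pull back. *)
Lemma gp_identificationP y :
  exists a b, [/\ S (iota a), S (iota b) & y = a - b].
Proof.
have [iota_inj iotaE] := iota_gp.
have S_iota x : S x -> exists a, iota a = x.
  move=> Sx; have : gp S x.
    by exists x, 0; split; rewrite ?subr0//; apply: affine_semigroup0.
  by rewrite -iotaE => -[a _ <-]; exists a.
have : gp S (iota y) by rewrite -iotaE; exists y.
move=> [u [v [Su Sv yE]]].
have [[a aE] [b bE]] := (S_iota _ Su, S_iota _ Sv).
exists a, b; rewrite aE bE; split=> //.
by apply: iota_inj; rewrite yE raddfB aE bE.
Qed.

Lemma gp_ext_lform : exists ell : 'I_n -> 'rV[int]_r,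
  forall y j, gp_ext S xi (iota y) 0 j = lform (ell j) y.
Proof.
have extB : zmod_morphism (gp_ext S xi \o iota).
  move=> x y /=.
  have [a [b [Sa Sb ->]]] := gp_identificationP x.
  have [c [d [Sc Sd ->]]] := gp_identificationP y.
  have [_ _ xiD _] := xi_emb.
  have -> : a - b - (c - d) = (a + d) - (b + c).
    by rewrite opprB addrACA -opprD.
  rewrite !(raddfB iota) !(raddfD iota) !gp_extB//; try exact: affine_semigroupD.
  by rewrite !xiD// opprB opprD addrACA.
pose f : {additive 'rV[int]_r -> 'rV[int]_n} :=
  HB.pack (gp_ext S xi \o iota) (GRing.isZmodMorphism.Build _ _ _ extB).
exists (fun j => \row_k f (delta_mx 0 k) 0 j) => y j.
exact: (additive_lform f).
Qed.

(** Injectivity of [xi] is given on [S] only, so the equation of differences is first turned into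
    one of sums. *)
Lemma gp_ext_inj y z :
  gp_ext S xi (iota y) = gp_ext S xi (iota z) -> y = z.
Proof.
have [_ _ xiD xi_inj] := xi_emb.
have [a [b [Sa Sb ->]]] := gp_identificationP y.
have [c [d [Sc Sd ->]]] := gp_identificationP z.
rewrite !(raddfB iota) !gp_extB// => /eqP.
rewrite subr_eq addrAC eq_sym subr_eq -!xiD// => /eqP.
move=> /xi_inj E; have [iota_inj _] := iota_gp.
apply/eqP; rewrite subr_eq addrAC eq_sym subr_eq; apply/eqP/iota_inj.
by rewrite !(raddfD iota) E//; exact: affine_semigroupD.
Qed.

(** Differences of elements of the image of [S] are exactly the values of the extension, and its
    injectivity lets membership in the image be read back as membership in [S]. *)
Lemma pure_embeddingP : pure_embedding S (@nonneg_orthant n) xi <->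
  (forall y, (forall j, 0 <= gp_ext S xi (iota y) 0 j) -> S (iota y)).
Proof.
have [xi_ge0 xi0 xiD xi_inj] := xi_emb.
have [_ iotaE] := iota_gp.
split=> [[_ [_ pureE]] y y0|h].
  have : (xi @` S) (gp_ext S xi (iota y)).
    rewrite pureE; split=> //.
    have [a [b [Sa Sb ->]]] := gp_identificationP y.
    exists (xi (iota a)), (xi (iota b)).
    by rewrite (raddfB iota) gp_extB//; split.
  move=> [x Sx xE].
  have [a _ ax] : range iota x.
    by rewrite iotaE; exists x, 0; rewrite subr0; split=> //;
      apply: affine_semigroup0.
  suff -> : y = a by rewrite ax.
  by apply: gp_ext_inj; rewrite ax -xE gp_ext_id.
have sub : xi @` S `<=` @nonneg_orthant n by move=> _ [z Sz <-]; exact: xi_ge0.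
split=> //; split=> //; apply/seteqP; split=> [z Sz|z [z0]].
  split; first exact: sub.
  by exists z, 0; rewrite subr0; split=> //; exists 0 => //;
    apply: affine_semigroup0.
move=> [_ [_ [[a Sa <-] [b Sb <-] zE]]].
have [y _ yE] : range iota (a - b) by rewrite iotaE; exists a, b.
have Sy : S (iota y) by apply: h => j; rewrite yE gp_extB// -zE.
by exists (iota y) => //; rewrite -gp_ext_id// yE gp_extB.
Qed.

End Extension.

(** * Characterization of pure embeddings by support forms *)

Theorem proposition2p2 (R : realType) (m r s n : nat)
    (S : set 'rV[int]_m) (iota : {additive 'rV[int]_r -> 'rV[int]_m})
    (sigma : 'I_s -> 'rV[int]_r) (xi : 'rV[int]_m -> 'rV[int]_n)
    (S_affine : affine_semigroup S)
    (S_positive : positive_semigroup S)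
    (S_normal : normal_semigroup S)
    (iota_gp : gp_identification S iota)
    (sigma_supp : support_forms R (iota @^-1` S) sigma)
    (xi_emb : embedding S (@nonneg_orthant n) xi) :
  (pure_embedding S (@nonneg_orthant n) xi <->
     exists (hsn : (s <= n)%N) (pi : 'S_n),
       starts_with_support_forms S iota sigma xi hsn pi) /\
  (forall (hsn : (s <= n)%N) (pi : 'S_n),
     starts_with_support_forms S iota sigma xi hsn pi ->
     forall j : 'I_n, (s <= j)%N ->
       exists q : 'I_s -> rat,
         (forall i, 0 <= q i) /\
         forall y : 'rV[int]_r,
           (gp_ext S xi (iota y) 0 (pi j))%:~R
           = \sum_(i < s) q i * (lform (sigma i) y)%:~R).
Proof.
have [iota_inj iotaE] := iota_gp.
have [cop CE irr] := sigma_supp.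
have [xi_ge0 _ _ _] := xi_emb.
have [ell ellE] := gp_ext_lform S_affine xi_emb iota_gp.
have A_gp := gp_identificationP S_affine iota_gp.
(* Normality passes from [S] to its preimage because [iota] has range [gp S]. *)
have A_normal y : cone R (iota @^-1` S) (map_mx intr y) -> S (iota y).
  apply: normal_cone_int => [|u v Su Sv|u k k0 Su] /=.
  - by rewrite raddf0; exact: affine_semigroup0.
  - by rewrite raddfD; exact: affine_semigroupD.
  - by apply: (@S_normal _ k) => //; [rewrite -iotaE; exists u|rewrite -raddfMn].
have ell_ge0 j y : S (iota y) -> 0 <= lform (ell j) y.
  by move=> Sy; rewrite -ellE (gp_ext_id S_affine xi_emb)//; exact: xi_ge0.
split; last first.
  move=> hsn pi _ j _.
  have [q [q0 qE]] := support_forms_comb sigma_supp (@ell_ge0 (pi j)).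
  exists q; split=> // y; rewrite ellE -lform_intr (lform_comb _ qE).
  (* On rational numbers [ratr] is the identity. *)
  by apply: eq_bigr => i _; rewrite lform_intr -(fmorph_eq_rat idfun).
rewrite (pure_embeddingP S_affine xi_emb iota_gp); split=> [h|].
  have AE y : (iota @^-1` S) y <-> forall j, 0 <= lform (ell j) y.
    by split=> [Sy j|y0]; [exact: ell_ge0|apply: h => j; rewrite ellE].
  have /choice[f /choice[e fe]] := support_form_among sigma_supp A_gp AE.
  (* Two support forms with a common positive multiple coincide; injectivity gives both [s <= n] and
     the renumbering. *)
  have f_inj : injective f.
    move=> i i' ff; have [e0 fE] := fe i; have [e0' fE'] := fe i'.
    by apply: (support_form_scale sigma_supp e0 e0'); rewrite -fE -fE' ff.
  have hsn : (s <= n)%N by have := leq_card f f_inj; rewrite !card_ord.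
  have [pi piE] := injection_extends_perm hsn f_inj.
  exists hsn, pi, e => i; have [e0 fE] := fe i; split=> // y.
  by rewrite piE ellE fE lformC lformZ lformC.
(* As the factors [e i] are positive, non-negative components force all support forms to be
   non-negative at [y], which places [y] in the cone. *)
move=> [hsn [pi [e eE]]] y y0; apply: A_normal; rewrite CE => i /=.
have [e0 eiE] := eE i.
by rewrite lform_intr ler0z -(pmulr_rge0 _ e0) -eiE.
Qed.
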